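(* Let $X$ be a compact subset of $\mathbb{R}^d$, let $K$ be a continuous positive definite kernel on $X$ with RKHS $\mathcal{H}$, and let $(x_i,y_i)$, $i=1,\dots,n$, be random elements of $X\times\mathbb{R}$ defined on a probability space $(\Omega,\mathcal{A},\mathbb{P})$ with $y_i=f_0(x_i)+\epsilon_i$, where $x_1,\dots,x_n$ are i.i.d. with distribution $v$ supported on all of $X$ (i.e. $v(O)>0$ for every non-empty relatively open $O\subset X$). Suppose that $\rho:\mathbb{R}\to\mathbb{R}$ is continuous and bounded from below, i.e. $\inf_{x\in\mathbb{R}}\rho(x)\ge C$ for some $C\in\mathbb{R}$, and that $\lambda>0$. Then the estimator $$\widehat f_n\in\operatorname*{argmin}_{f\in\mathcal{H}}\Big[\frac1n\sum_{i=1}^n\rho(y_i-f(x_i))+\lambda\|f\|_{\mathcal{H}}^2\Big]$$ is well-defined as an element of $\mathcal{H}$ and measurable; that is, for every $\omega\in\Omega$ the objective function attains its infimum over $\mathcal{H}$, and a minimizer $\widehat f_n(\omega)$ can be chosen so that $\omega\mapsto\widehat f_n(\omega)\in\mathcal{H}$ is measurable.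
   Context: A symmetric kernel $K:X\times X\to\mathbb{R}$ is positive definite if $\sum_{j,k=1}^N a_ja_kK(w_j,w_k)>0$ for all $N\in\mathbb{N}$, all pairwise distinct $w_1,\dots,w_N\in X$ and all $a\in\mathbb{R}^N\setminus\{0\}$. $\mathcal{H}$ is its reproducing kernel Hilbert space of real functions on $X$, with norm $\|\cdot\|_{\mathcal{H}}$. $f_0:\mathbb{R}^d\to\mathbb{R}$ is the regression function and $\epsilon_i$ are i.i.d. real random variables. No convexity of $\rho$ is assumed; measurability is with respect to the Borel $\sigma$-algebra of $\mathcal{H}$. *)

(* Defs.v *)
From HB Require Import structures.
From mathcomp Require Export all_boot all_order all_algebra sesquilinear.
From mathcomp Require Export all_classical all_reals all_analysis.

Set Implicit Arguments.
Unset Strict Implicit.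
Unset Printing Implicit Defensive.

Export Order.TTheory GRing.Theory Num.Theory.
Export numFieldNormedType.Exports.

Open Scope classical_set_scope.
Open Scope ring_scope.

Notation borel T := (g_sigma_algebraType (@open T)).

Definition argmin {R : realType} {T : Type} (F : T -> R) : set T :=
  [set f | forall g, F f <= F g].

Section kernels.
Context {R : realType} {T : Type}.

Definition symmetric_kernel (K : T -> T -> R) := forall x y, K x y = K y x.

(* Strict positivity, on pairwise distinct points. *)
Definition positive_definite_kernel (K : T -> T -> R) :=
  symmetric_kernel K /\
  forall (N : nat) (w : 'I_N -> T) (a : 'rV[R]_N),
    injective w -> a != 0 ->
    0 < \sum_(j < N) \sum_(k < N) a 0 j * a 0 k * K (w j) (w k).

(* A Hilbert space [rkhs_space] whose elements are functions on T: the linear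
   injection [rkhs_eval] sends an element to the function that it is. Its norm
   is the one induced by the inner product, it contains the kernel sections
   K(., x), and K has the reproducing property. By the Moore-Aronszajn theorem
   these conditions determine the space up to an isometry commuting with
   [rkhs_eval]. *)
Record rkhs (K : T -> T -> R) := Rkhs {
  rkhs_space :> completeNormedModType R ;
  rkhs_dot : {dot rkhs_space for idfun} ;
  rkhs_normE : forall f : rkhs_space, `|f| ^+ 2 = rkhs_dot f f ;
  rkhs_eval : {linear rkhs_space -> (T -> R^o)} ;
  rkhs_eval_inj : injective rkhs_eval ;
  rkhs_section : T -> rkhs_space ;
  rkhs_sectionE : forall x, rkhs_eval (rkhs_section x) = K ^~ x ;
  rkhs_reproducing : forall (f : rkhs_space) x,
    rkhs_eval f x = rkhs_dot f (rkhs_section x) }.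

End kernels.

Section objective.
Context {R : realType} {T : Type} {K : T -> T -> R}.

Definition penalized_risk (H : rkhs K) (rho : R -> R) (lambda : R) (n : nat)
    (x : 'I_n -> T) (y : 'I_n -> R) (f : H) : R :=
  n%:R^-1 * \sum_(i < n) rho (y i - rkhs_eval H f (x i)) + lambda * `|f| ^+ 2.

End objective.

Section iid.
Context {R : realType} {d d' : measure_display} {Omega : measurableType d}
  {T : measurableType d'}.

Definition mutually_independent (P : probability Omega R) (I : finType)
    (X : I -> Omega -> T) :=
  forall (J : {set I}) (A : I -> set T), (forall i, measurable (A i)) ->
    P (\bigcap_(i in [set` J]) (X i @^-1` A i)) =
    (\prod_(i in J) P (X i @^-1` A i))%E.

Definition iid_with_law (P : probability Omega R) (mu : probability T R) (I : finType)
    (X : I -> Omega -> T) :=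
  [/\ forall i, measurable_fun setT (X i),
      forall i (A : set T), measurable A -> P (X i @^-1` A) = mu A &
      mutually_independent P X].

End iid.

(* Main.v *)
(* The reproducing property splits every f in H as its interpolant in the span
   of the sections K(., x_i) plus a function that vanishes at the x_i and is
   orthogonal to that span. So only the span matters, and there the objective
   is coercive (the Gram matrix of the distinct sample points is invertible) and
   attains its infimum. Hence it suffices to minimize over the coefficients
   b in R^n. These minimizers need not be unique, nor form a compact set when
   sample points coincide, but the objective is measurable in omega and
   continuous in b, so for every closed D the set of omega whose argmin meets D
   is measurable. Intersecting the argmin repeatedly with the first set that it
   meets in a countable cover by small closed sets gives a measurable choice. *)
Require Import Defs.
From mathcomp Require Import measurable_realfun ring lra.

(** * Strong measurability and preimages of open sets *)

Section strongly_measurable.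
Context {R : realType} {disp : measure_display} {Omega : measurableType disp}.

(* Pointwise limits of countably valued measurable functions. Unlike Borel
   measurability, this passes to sums without separability of the codomain. *)
Definition strongly_measurable {V : topologicalType} (f : Omega -> V) :=
  exists (g : nat -> Omega -> nat) (h : nat -> nat -> V),
    (forall m k, measurable (g m @^-1` [set k])) /\
    forall w, h m (g m w) @[m --> \oo] --> f w.

Lemma measurable_countable_preimage (g : Omega -> nat) :
  (forall k, measurable (g @^-1` [set k])) -> forall A, measurable (g @^-1` A).
Proof.
move=> mg A; rewrite (_ : _ @^-1` _ = \bigcup_(k in A) (g @^-1` [set k])).
  by apply: bigcup_measurable => k _.
by apply/seteqP; split => [w Aw|w [k Ak] /= ->]//; exists (g w).
Qed.

(** Coding the two approximating indices as one by [pickle] keeps the approximants countably valued,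
    so no sigma-algebra on [V1 * V2] is involved. The default [(0, 0)] only serves codes that are
    never reached. *)
Lemma strongly_measurable_comp2 {V1 V2 V : topologicalType} (F : V1 * V2 -> V)
    (f1 : Omega -> V1) (f2 : Omega -> V2) :
  continuous F -> strongly_measurable f1 -> strongly_measurable f2 ->
  strongly_measurable (fun w => F (f1 w, f2 w)).
Proof.
move=> cF [g1 [h1 [mg1 cv1]]] [g2 [h2 [mg2 cv2]]].
exists (fun m w => pickle (g1 m w, g2 m w)).
exists (fun m k => let p := odflt (0%N, 0%N) (unpickle k) in
                   F (h1 m p.1, h2 m p.2)).
split=> [m k|w].
  rewrite (_ : _ @^-1` _ = \bigcup_(i in setT)
     \bigcup_(j in [set j | pickle (i, j) = k])
       (g1 m @^-1` [set i] `&` g2 m @^-1` [set j])).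
    by apply: bigcup_measurable => i _; apply: bigcup_measurable => j _;
      exact: measurableI.
  apply/seteqP; split => [w /= <-|w [i _ [j /= <- [-> ->]]]//].
  by exists (g1 m w) => //; exists (g2 m w).
under eq_fun do rewrite pickleK /=.
apply: (@cvg_comp _ _ _ (fun m => (h1 m (g1 m w), h2 m (g2 m w))) F
  _ _ _ (cvg_pair (cv1 w) (cv2 w))).
exact: cF.
Qed.

Lemma strongly_measurable_comp {V1 V : topologicalType} (F : V1 -> V)
    (f : Omega -> V1) :
  continuous F -> strongly_measurable f -> strongly_measurable (F \o f).
Proof.
move=> cF mf.
apply: (@strongly_measurable_comp2 _ _ _ (F \o fst)) (mf) (mf) => p.
by apply: continuous_comp; [exact: cvg_fst|exact: cF].
Qed.

Lemma strongly_measurable_cst {V : topologicalType} (a : V) :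
  strongly_measurable (fun _ : Omega => a).
Proof.
exists (fun _ _ => 0%N), (fun _ _ => a); split => [m k|w]; last exact: cvg_cst.
by rewrite preimage_cst; case: ifP.
Qed.

Lemma strongly_measurable_sum {V : normedModType R} (I : Type) (r : seq I)
    (f : I -> Omega -> V) :
  (forall i, strongly_measurable (f i)) ->
  strongly_measurable (fun w => \sum_(i <- r) f i w).
Proof.
move=> mf; elim: r => [|i r ih].
  under eq_fun do rewrite big_nil; exact: strongly_measurable_cst.
under eq_fun do rewrite big_cons.
exact: (@strongly_measurable_comp2 _ _ _ (fun p : V * V => p.1 + p.2) _ _
  (@add_continuous V) (mf i) ih).
Qed.

(** A point [f w] lies in [U] exactly when, for some fixed radius [1/(k+1)], the balls around the
    approximants are eventually contained in [U]. This involves only countable unions and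
    intersections of preimages under the indices [g m]. *)
Lemma strongly_measurable_open {V : pseudoMetricType R} (f : Omega -> V)
    (U : set V) :
  strongly_measurable f -> open U -> measurable (f @^-1` U).
Proof.
move=> [g [h [mg cv]]] oU.
rewrite (_ : _ @^-1` _ = \bigcup_(k in setT) \bigcup_(N in setT)
   \bigcap_(m in [set m | (N <= m)%N])
     (g m @^-1` [set j | ball (h m j) k.+1%:R^-1 `<=` U])).
  apply: bigcup_measurable => k _; apply: bigcup_measurable => N _.
  by apply: bigcap_measurableType => m _; exact: measurable_countable_preimage.
apply/seteqP; split=> w.
  move=> Uw; have /nbhs_ballP[e /= e0 eU] := open_nbhs_nbhs (conj oU Uw).
  have e20 : 0 < e / 2 by rewrite divr_gt0.
  have [k _ /(_ k (leqnn k)) /= ke] := near_infty_natSinv_lt (PosNum e20).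
  have [N _ Nw] := cvg_ball (cv w) e20.
  exists k => //; exists N => // m /= /Nw hm z mz; apply: eU.
  rewrite (splitr e); apply: ball_triangle hm _.
  exact: le_ball (ltW ke) _ mz.
move=> [k _ [N _ NU]] /=.
have k0 : 0 < k.+1%:R^-1 :> R by rewrite invr_gt0.
have [M _ Mw] := cvg_ball (cv w) k0.
have := NU (maxn N M) (leq_maxl _ _); apply.
by apply/ball_sym/Mw; exact: leq_maxr.
Qed.

Lemma open_preimage_measurable_fun (f : Omega -> R) :
  (forall U, open U -> measurable (f @^-1` U)) -> measurable_fun setT f.
Proof.
move=> mf; apply: (measurability _ (RGenOInfty.measurableE R)).
move=> _ [_ [x ->] <-]; rewrite setTI; apply: mf; exact: interval_open.
Qed.

Lemma strongly_measurable_realfun (f : Omega -> R) :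
  strongly_measurable f -> measurable_fun setT f.
Proof.
by move=> mf; apply: open_preimage_measurable_fun => U;
  exact: strongly_measurable_open.
Qed.

Lemma strongly_measurable_borel {V : pseudoPMetricType R} (f : Omega -> V) :
  strongly_measurable f -> measurable_fun setT (f : Omega -> borel V).
Proof.
move=> mf; apply: (@measurability _ _ _ (borel V) _ _ (@open V)) => //.
move=> _ [U oU <-]; rewrite setTI; exact: strongly_measurable_open.
Qed.

Lemma first_index_measurable (P : nat -> set Omega) :
  (forall j, measurable (P j)) -> (forall w, exists j, P j w) ->
  exists g : Omega -> nat,
    (forall k, measurable (g @^-1` [set k])) /\ forall w, P (g w) w.
Proof.
move=> mP exP.
have exPb w : exists j, `[< P j w >].
  by have [j] := exP w; exists j; exact/asboolP.
exists (fun w => ex_minn (exPb w)); split=> [k|w]; last first.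
  by case: ex_minnP => j /asboolP.
rewrite (_ : _ @^-1` _ = P k `&` \bigcap_(j in [set j | (j < k)%N]) ~` P j).
  apply: measurableI => //; apply: bigcap_measurableType => j _.
  exact: measurableC.
apply/seteqP; split=> w /=.
  case: ex_minnP => j /asboolP Pj jmin <-; split => // i /= ij Pi.
  by have /jmin := asboolT Pi; rewrite leqNgt ij.
case: ex_minnP => j /asboolP Pj jmin [Pk kmin].
have := jmin _ (asboolT Pk); rewrite leq_eqVlt => /orP[/eqP//|jk].
by have := kmin _ jk Pj.
Qed.

(** A converse of [strongly_measurable_open] for maps whose values are covered by a countable net at
    every scale: the first net point close enough to [f w] is an approximant. *)
Lemma open_preimage_strongly_measurable {V : pseudoMetricType R}
    (f : Omega -> V) (q : nat -> nat -> V) :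
  (forall U, open U -> measurable (f @^-1` U)) ->
  (forall m w, exists j, ball (q m j) m.+1%:R^-1 (f w)) ->
  strongly_measurable f.
Proof.
move=> mf netq.
have m0 m : 0 < m.+1%:R^-1 :> R by rewrite invr_gt0.
have step m : exists g : Omega -> nat,
    (forall k, measurable (g @^-1` [set k])) /\
    forall w, (ball (q m (g w)) (2 * m.+1%:R^-1)) (f w).
  (* Balls need not be open here, so interiors are used; doubling the radius puts [f w] in the
     interior. *)
  have [j|w|g [mg gP]] := @first_index_measurable
    (fun j => f @^-1` (ball (q m j) (2 * m.+1%:R^-1))°).
  - by apply: mf; exact: open_interior.
  - have [j jP] := netq m w; exists j => /=.
    apply/nbhs_ballP; exists m.+1%:R^-1; first exact: m0.
    move=> z wz; rewrite mulr_natl mulr2n; exact: ball_triangle jP _.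
  - by exists g; split => // w; exact: (interior_subset (gP w)).
have {step}[g gP] := choice step.
exists g, q; split => [m|w]; first by have [] := gP m.
apply/cvg_ballP => e e0.
have e20 : 0 < e / 2 by rewrite divr_gt0.
apply: filterS (near_infty_natSinv_lt (PosNum e20)) => m /= me.
apply/ball_sym; have [_ /(_ w)] := gP m; apply: le_ball.
by rewrite -ler_pdivlMl// mulrC ltW.
Qed.

Lemma compact_range_strongly_measurable {V : pseudoPMetricType R}
    (f : Omega -> V) (C : set V) :
  compact C -> (forall w, C (f w)) ->
  (forall U, open U -> measurable (f @^-1` U)) -> strongly_measurable f.
Proof.
move=> cC Cf mf.
have m0 m : 0 < m.+1%:R^-1 :> R by rewrite invr_gt0.
have netC m : exists q : nat -> V,
    forall w, exists j, ball (q j) m.+1%:R^-1 (f w).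
  have := cC; rewrite compact_cover => /(_ V setT
    (fun v => (ball v m.+1%:R^-1)°)) [].
  - by move=> v _; exact: open_interior.
  - move=> v _; exists v => //; apply: nbhsx_ballx; exact: m0.
  (* The default [point] merely extends the finite net to a sequence. *)
  - move=> D _ CD; exists (nth point (finmap.enum_fset D)) => w.
    have [v vD vf] := CD _ (Cf w).
    exists (index v (finmap.enum_fset D)); rewrite nth_index//.
    exact: (interior_subset vf).
have [q qP] := choice netC.
exact: (@open_preimage_strongly_measurable _ f q mf qP).
Qed.

End strongly_measurable.

(** * Measurable selection from sets of minimizers *)

Section measurable_selection.
Context {R : realType} {disp : measure_display} {Omega : measurableType disp}
  {V : pseudoMetricType R}.

(** Measurability of a set-valued map, tested on closed sets rather than open ones so that it
    survives cutting [S] by closed sets. *)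
Definition hitting_measurable (S : Omega -> set V) :=
  forall D, closed D -> measurable [set w | S w `&` D !=set0].

Lemma hitting_measurable_refine (S : Omega -> set V) (C : nat -> set V) :
  (forall j, closed (C j)) -> hitting_measurable S ->
  (forall w, exists j, S w `&` C j !=set0) ->
  exists g : Omega -> nat,
    [/\ forall k, measurable (g @^-1` [set k]),
        forall w, S w `&` C (g w) !=set0 &
        hitting_measurable (fun w => S w `&` C (g w))].
Proof.
move=> cC mS SC.
have [j|g [mg gP]] :=
  first_index_measurable (fun j => [set w | S w `&` C j !=set0]) _ SC.
  exact: mS.
exists g; split => // D cD.
rewrite (_ : mkset _ = \bigcup_(k in setT)
    (g @^-1` [set k] `&` [set w | S w `&` (C k `&` D) !=set0])).
  apply: bigcup_measurable => k _; apply: measurableI => //.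
  by apply: mS; exact: closedI.
apply/seteqP; split => w /=; first by rewrite -setIA; exists (g w).
by move=> [k _ [/= <-]]; rewrite setIA.
Qed.

(** Cantor's intersection theorem: a cluster point of points chosen in the [A m] lies in each of
    these closed sets. *)
Lemma nested_compact_nonempty (A : nat -> set V) :
  compact (A 0%N) -> (forall m, closed (A m)) -> (forall m, A m !=set0) ->
  (forall m, A m.+1 `<=` A m) -> \bigcap_m A m !=set0.
Proof.
move=> cA clA A0 decA.
have Ale i j : (i <= j)%N -> A j `<=` A i.
  elim: j => [|j ih]; first by rewrite leqn0 => /eqP ->.
  rewrite leq_eqVlt => /orP[/eqP -> //|ij].
  by apply: subset_trans (ih ij); exact: decA.
have [b bA] := choice A0.
have [|c [_ cl]] := cA (b m @[m --> \oo]) _.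
  by exists 0%N => // m _; apply: (Ale 0%N m) => //; exact: bA.
exists c => m _; apply: clA => B cB.
have [|z [Az Bz]] := cl (A m) B _ cB; last by exists z.
by exists m => // i /= mi; exact: Ale mi _ (bA i).
Qed.

Lemma closure_ball_sub (x : V) (e : R) : 0 < e ->
  closure (ball x e) `<=` ball x (2 * e).
Proof.
move=> e0 y /(_ _ (nbhsx_ballx y _ e0)) [z [xz /ball_sym zy]].
by rewrite mulr_natl mulr2n; exact: ball_triangle xz zy.
Qed.

(** Stage [m] cuts the current set by the closure of a ball of radius [1/(m+1)] around a net point.
    Compactness keeps the intersection of all stages nonempty, and the net points selected converge
    to any point of it, which makes the choice strongly measurable. *)
Lemma compact_valued_selection (S : Omega -> set V) (q : nat -> V) :
  (forall (a : V) (e : R), 0 < e -> exists j, ball (q j) e a) ->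
  hitting_measurable S -> (forall w, compact (S w)) ->
  (forall w, closed (S w)) -> (forall w, S w !=set0) ->
  exists a : Omega -> V, strongly_measurable a /\ forall w, S w (a w).
Proof.
move=> dq mS cS clS S0.
pose good (T : Omega -> set V) :=
  [/\ hitting_measurable T, forall w, closed (T w) & forall w, T w !=set0].
pose C m j := closure (ball (q j) (m.+1%:R^-1 : R)).
have m0 m : 0 < m.+1%:R^-1 :> R by rewrite invr_gt0.
have refine (mT : nat * {T | good T}) : exists g : Omega -> nat,
    (forall k, measurable (g @^-1` [set k])) /\
    good (fun w => sval mT.2 w `&` C mT.1 (g w)).
  case: mT => m [T /= [mT clT T0]].
  have clC j : closed (C m j) by exact: closed_closure.
  have [w|g [mg g0 mTC]] := hitting_measurable_refine _ _ clC mT _.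
    have [t Tt] := T0 w; have [j qj] := dq t _ (m0 m).
    by exists j, t; split => //; exact: subset_closure.
  by exists g; split => //; split => // w; exact: closedI.
have {refine}[g gP] := choice refine.
(* Each stage carries its proof of [good], which the next refinement requires. *)
pose T := fix T m : {T | good T} := if m is k.+1 then
    exist good _ (proj2 (gP (k, T k))) else exist good S (And3 mS clS S0).
pose gT m := g (m, T m).
have TS m w : sval (T m.+1) w = sval (T m) w `&` C m (gT m w) by [].
have Tne w : \bigcap_m sval (T m) w !=set0.
  apply: nested_compact_nonempty => [|m|m|m]; first exact: cS.
  - by have [_] := svalP (T m).
  - by have [_ _] := svalP (T m).
  - by rewrite TS; exact: subIsetl.
have {Tne}[a aT] := choice Tne.
exists a; split; last by move=> w; exact: aT w 0%N I.
exists gT, (fun _ => q); split => [m|w]; first by have [] := gP (m, T m).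
apply/cvg_ballP => e e0.
have e20 : 0 < e / 2 by rewrite divr_gt0.
apply: filterS (near_infty_natSinv_lt (PosNum e20)) => m /= me.
apply/ball_sym; have := aT w m.+1 I; rewrite TS => -[_].
move/(closure_ball_sub _ _ (m0 m)); apply: le_ball.
by rewrite -ler_pdivlMl// mulrC ltW.
Qed.

Lemma closed_argmin (F : V -> R) : continuous F -> closed (argmin F).
Proof.
move=> cF.
rewrite (_ : argmin F = \bigcap_(g in setT) (F @^-1` [set t | t <= F g])).
  by apply: closed_bigI => g _; apply: closed_comp => //; exact: closed_le.
by apply/seteqP; split => [f fmin g _|f fmin g]; [exact: fmin|exact: fmin].
Qed.

(** The argmin meets [D] exactly when, for every [k], some net point within [1/(k+1)] of [D] has a
    value less than [1/(k+1)] above the value at any net point. Continuity extends the comparison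
    from the net to all of [V], and compactness of [D] provides a limit of the nearby points. *)
Lemma compact_argmin_hitting (Phi : Omega -> V -> R) (q : nat -> V)
    (D : set V) :
  (forall (a : V) (e : R), 0 < e -> exists j, ball (q j) e a) ->
  (forall w, continuous (Phi w)) ->
  (forall a, measurable_fun setT (Phi ^~ a)) -> compact D ->
  measurable [set w | argmin (Phi w) `&` D !=set0].
Proof.
move=> dq cPhi mPhi cD.
have m0 m : 0 < m.+1%:R^-1 :> R by rewrite invr_gt0.
have near_q w a (e : R) : 0 < e ->
    exists j, ball (q j) e a /\ Phi w (q j) < Phi w a + e.
  move=> e0; have /cvgrPdist_lt/(_ _ e0)/nbhs_ballP[r /= r0 rP] := cPhi w a.
  have re0 : 0 < Num.min r e by rewrite lt_min r0 e0.
  have [j jP] := dq a _ re0.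
  exists j; split; first by apply: le_ball jP; rewrite ge_min lexx orbT.
  have /rP/= : ball a r (q j).
    by apply/ball_sym; apply: le_ball jP; rewrite ge_min lexx.
  by rewrite ltr_distlC => /andP[].
rewrite (_ : mkset _ = \bigcap_(k in setT)
    \bigcup_(j in [set j | exists2 a, D a & ball (q j) k.+1%:R^-1 a])
    \bigcap_(l in setT)
      [set w | Phi w (q j) < Phi w (q l) + k.+1%:R^-1]).
  apply: bigcap_measurableType => k _; apply: bigcup_measurable => j _.
  apply: bigcap_measurableType => l _.
  rewrite -[X in measurable X]setTI.
  apply: (measurable_fun_ltr _ _ measurableT _ (Y := [set true])) => //.
  exact: measurable_funD.
apply/seteqP; split => [w [a [amin Da]] k _|w hw].
  have [j [aj Pj]] := near_q w a _ (m0 k).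
  exists j; first by exists a.
  by move=> l _ /=; apply: lt_le_trans Pj _; rewrite lerD2r; exact: amin.
have {hw} hw k : exists aj : V * nat,
  [/\ D aj.1, ball (q aj.2) k.+1%:R^-1 aj.1 &
    forall l, Phi w (q aj.2) < Phi w (q l) + k.+1%:R^-1].
  by have [j [a Da aj] jl] := hw k I; exists (a, j); split => // l; exact: jl.
have {hw}[u uP] := choice hw.
have [|a [Da cla]] := cD ((u k).1 @[k --> \oo]) _.
  by exists 0%N => // k _; have [] := uP k.
exists a; split => // b; rewrite leNgt; apply/negP => ba.
(* A third of the gap for each error: from [a] to the net point near it, the tolerance [1/(k+1)],
   and from [b] to the net point [q l]. *)
pose e := (Phi w a - Phi w b) / 3.
have e0 : 0 < e by rewrite divr_gt0// subr_gt0.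
have /cvgrPdist_lt/(_ _ e0)/nbhs_ballP[r /= r0 rP] := cPhi w a.
have r20 : 0 < r / 2 by rewrite divr_gt0.
have [l [_ Pl]] := near_q w b _ e0.
(* Clustering returns only a point; [U] makes it bring along a sufficiently large index [k]. *)
pose U z := exists k, [/\ z = (u k).1, k.+1%:R^-1 < e & k.+1%:R^-1 < r / 2].
have nearU : \forall k \near \oo, U (u k).1.
  near=> k; exists k; split => //.
  - by near: k; exact: (near_infty_natSinv_lt (PosNum e0)).
  - by near: k; exact: (near_infty_natSinv_lt (PosNum r20)).
have [_ [[k [-> ke kr]] az]] := cla _ _ nearU (nbhsx_ballx a _ r20).
have [_ qu Pu] := uP k.
have : ball a r (q (u k).2).
  rewrite (splitr r); apply: ball_triangle az _.
  by apply/ball_sym; apply: le_ball qu; exact: ltW.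
move/rP => /=; rewrite ltr_distlC => /andP[h _].
have eE : Phi w a - Phi w b = e * 3 by rewrite divfK// pnatr_eq0.
have := Pu l; clearbody e; move: ke; move: (k.+1%:R^-1) => t ke Pul; lra.
Unshelve. all: by end_near. Qed.

(** The argmin is closed but possibly not compact. The compact cover [B] is used twice: it reduces
    hitting a closed set to hitting countably many compact ones, and one refinement by [B] makes the
    argmin compact-valued. *)
Lemma measurable_argmin (Phi : Omega -> V -> R) (q : nat -> V)
    (B : nat -> set V) :
  (forall (a : V) (e : R), 0 < e -> exists j, ball (q j) e a) ->
  (forall j, compact (B j)) -> (forall j, closed (B j)) ->
  (forall a, exists j, B j a) ->
  (forall w, continuous (Phi w)) ->
  (forall a, measurable_fun setT (Phi ^~ a)) ->
  (forall w, argmin (Phi w) !=set0) ->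
  exists a : Omega -> V,
    strongly_measurable a /\ forall w, argmin (Phi w) (a w).
Proof.
move=> dq cB clB coverB cPhi mPhi ne.
have mA : hitting_measurable (fun w => argmin (Phi w)).
  move=> D clD; rewrite (_ : mkset _ = \bigcup_(j in setT)
    [set w | argmin (Phi w) `&` (D `&` B j) !=set0]).
    apply: bigcup_measurable => j _.
    apply: compact_argmin_hitting _ q _ dq _ _ _ => //.
    by rewrite setIC; exact: compact_closedI.
  apply/seteqP; split => [w [a [Aa Da]]|w [j _ [a [Aa [Da _]]]]];
    last by exists a.
  by have [j Bj] := coverB a; exists j => //; exists a.
have [w|g [_ g0 mAB]] := hitting_measurable_refine _ _ clB mA _.
  by have [a Aa] := ne w; have [j Bj] := coverB a; exists j, a.
have clA w := closed_argmin _ (cPhi w).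
have [w|w|a [ma aP]] := compact_valued_selection _ q dq mAB _ _ g0.
- by rewrite setIC; exact: compact_closedI.
- exact: closedI.
- by exists a; split => // w; have [] := aP w.
Qed.

End measurable_selection.

(** * Linear combinations and repeated sample points *)

Section lincomb.
Context {R : realType} {V : normedModType R}.

Definition lincomb {n} (u : 'I_n -> V) (a : 'rV[R]_n) : V :=
  \sum_(i < n) a 0 i *: u i.

Lemma lincomb_continuous n (u : 'I_n -> V) : continuous (lincomb u).
Proof.
move=> a; rewrite /continuous_at /lincomb.
apply: (@cvg_big _ _ _ _ _ (@add_continuous V) _ (nbhs a)) => i _.
by apply: cvgZr_tmp; exact: coord_continuous.
Qed.

Lemma lincomb_mulmx n m (u : 'I_m -> V) (a : 'rV[R]_n) (A : 'M[R]_(n, m)) :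
  lincomb u (a *m A) = lincomb (fun i => lincomb u (row i A)) a.
Proof.
rewrite /lincomb; under eq_bigr do rewrite mxE scaler_suml.
rewrite exchange_big /=; apply: eq_bigr => i _; rewrite scaler_sumr.
by apply: eq_bigr => j _; rewrite scalerA mxE.
Qed.

(** The coefficient [b] at [j] collects those of [a] over the fibre of [s] above [j]. This returns
    from the distinct sample points to all [n] of them. *)
Lemma lincomb_comp n m (s : 'I_m -> 'I_n) (u : 'I_n -> V) (a : 'rV[R]_m) :
  exists b, lincomb u b = lincomb (u \o s) a.
Proof.
exists (a *m \matrix_(i, j) (s i == j)%:R); rewrite lincomb_mulmx.
apply: eq_bigr => i _; congr (_ *: _); rewrite /lincomb (bigD1 (s i))//=.
rewrite !mxE eqxx scale1r big1 ?addr0// => j jsi.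
by rewrite !mxE eq_sym (negbTE jsi) scale0r.
Qed.

Lemma sqr_norm_continuous : continuous (fun f : V => `|f| ^+ 2).
Proof.
move=> f; apply: (@cvg_comp _ _ _ (fun g : V => `|g|) (fun t => t ^+ 2)).
  exact: norm_continuous.
exact: exprn_continuous.
Qed.

End lincomb.

(** Keeps the first occurrence of each value, since positive definiteness speaks only of pairwise
    distinct points. *)
Lemma distinct_subfamily (T : eqType) n (x : 'I_n -> T) :
  exists (N : nat) (s : 'I_N -> 'I_n),
    injective (x \o s) /\ forall i, exists p, x (s p) = x i.
Proof.
pose J := [set i | [forall j : 'I_n, (x j == x i) ==> (i <= j)%N]]%SET.
exists #|J|, (@enum_val _ (mem J)); split => [p q /= xpq|i].
  apply: enum_val_inj; apply/val_inj/eqP => /=; rewrite eqn_leq.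
  have := enum_valP p; rewrite inE => /forallP/(_ (enum_val q)).
  have := enum_valP q; rewrite inE => /forallP/(_ (enum_val p)).
  by rewrite xpq eqxx /= => -> ->.
have [j /eqP xji jmin] :=
  @arg_minnP _ i (fun j => x j == x i) (fun j => j : nat) (eqxx (x i)).
have jJ : j \in J.
  by rewrite inE; apply/forallP => k; rewrite xji; exact/implyP/jmin.
by exists (enum_rank_in jJ j); rewrite enum_rankK_in.
Qed.

(** * Geometry of the RKHS and existence of a minimizer *)

Section rkhs_theory.
Context {R : realType} {T : topologicalType} {K : T -> T -> R}.
Variable H : rkhs K.
Implicit Types f g h : H.

Local Notation dot := (rkhs_dot H).
Local Notation section := (rkhs_section H).
Local Notation eval := (rkhs_eval H).

Lemma rkhs_dotC f g : dot f g = dot g f.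
Proof. by rewrite hermC /= expr0 mul1r. Qed.

Lemma rkhs_normD f g : `|f + g| ^+ 2 = `|f| ^+ 2 + 2 * dot f g + `|g| ^+ 2.
Proof.
by rewrite !rkhs_normE linearDl !linearDr /= (rkhs_dotC g f); ring.
Qed.

Lemma rkhs_normB f g : `|f - g| ^+ 2 = `|f| ^+ 2 - 2 * dot f g + `|g| ^+ 2.
Proof. by rewrite rkhs_normD normrN linearNr mulrN. Qed.

Lemma rkhs_dot_polarization f g :
  dot f g = (`|f + g| ^+ 2 - `|f - g| ^+ 2) / 4.
Proof. by rewrite rkhs_normD rkhs_normB; field. Qed.

Lemma rkhs_dot_continuous : continuous (fun p : H * H => dot p.1 p.2 : R).
Proof.
move=> p; under eq_fun do rewrite rkhs_dot_polarization.
rewrite /continuous_at.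
apply: cvgMr_tmp; apply: cvgB.
- apply: (@cvg_comp _ _ _ (fun q : H * H => q.1 + q.2) (fun f => `|f| ^+ 2));
    last exact: sqr_norm_continuous.
  by apply: cvgD; [exact: cvg_fst|exact: cvg_snd].
- apply: (@cvg_comp _ _ _ (fun q : H * H => q.1 - q.2) (fun f => `|f| ^+ 2));
    last exact: sqr_norm_continuous.
  by apply: cvgB; [exact: cvg_fst|exact: cvg_snd].
Qed.

(** A weak form of Cauchy-Schwarz, enough to turn a norm bound into a bound on point values. *)
Lemma rkhs_dot_le f g : `|dot f g| <= (`|f| ^+ 2 + `|g| ^+ 2) / 2.
Proof.
have := sqr_ge0 `|f - g|; have := sqr_ge0 `|f + g|.
by rewrite rkhs_normD rkhs_normB ler_norml => *; apply/andP; split; lra.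
Qed.

Hypothesis symK : symmetric_kernel K.

Lemma rkhs_dot_section x y : dot (section x) (section y) = K x y.
Proof. by rewrite -rkhs_reproducing rkhs_sectionE /= symK. Qed.

(** The squared distance between the sections at [x] and [y] is [K x x - 2 * K x y + K y y], which
    tends to 0 as [y] tends to [x]. *)
Lemma rkhs_section_continuous :
  continuous (fun p : T * T => K p.1 p.2) -> continuous section.
Proof.
move=> cK x; apply/cvgrPdist_lt => e e0.
have cvK (F G : T -> T) : F y @[y --> x] --> F x -> G y @[y --> x] --> G x ->
    K (F y) (G y) @[y --> x] --> K (F x) (G x).
  move=> cF cG; apply: (@cvg_comp _ _ _ (fun y => (F y, G y))
    (fun p => K p.1 p.2) _ _ _ (cvg_pair cF cG)).
  exact: cK (F x, G x).
have cv : (K x x - 2 * K x y + K y y) @[y --> x] -->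
    K x x - 2 * K x x + K x x.
  apply: cvgD; last by apply: cvK; exact: cvg_id.
  apply: cvgB; first exact: cvg_cst.
  by apply: cvgMl_tmp; apply: cvK; [exact: cvg_cst|exact: cvg_id].
have e20 : 0 < e ^+ 2 by rewrite exprn_gt0.
move/cvgrPdist_lt : cv => /(_ _ e20); apply: filterS => y.
have -> : K x x - 2 * K x x + K x x = 0 by ring.
rewrite sub0r normrN => /(le_lt_trans (ler_norm _)).
rewrite -!rkhs_dot_section -!rkhs_normE -rkhs_normB.
by rewrite ltr_pXn2r// nnegrE// ltW.
Qed.

Section minimizer.
Variables (rho : R -> R) (lambda : R) (n : nat) (x : 'I_n -> T) (y : 'I_n -> R).
Hypothesis cts_rho : continuous rho.
Local Notation J := (penalized_risk rho lambda x y : H -> R).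

Lemma penalized_risk_continuous : continuous J.
Proof.
move=> f; rewrite /continuous_at /penalized_risk.
apply: cvgD; apply: cvgMl_tmp; last exact: sqr_norm_continuous.
apply: (@cvg_big _ _ _ _ _ (@add_continuous R) _ (nbhs f)) => i _.
apply: (@cvg_comp _ _ _ (fun g => y i - eval g (x i)) rho);
  last exact: cts_rho.
apply: cvgB; first exact: cvg_cst.
under eq_fun do rewrite rkhs_reproducing.
rewrite rkhs_reproducing.
apply: (@cvg_comp _ _ _ (fun g => (g, section (x i)))
    (fun p => dot p.1 p.2) _ _ _ (cvg_pair cvg_id (cvg_cst _))).
exact: rkhs_dot_continuous (f, section (x i)).
Qed.

Lemma penalized_risk_le (f g : H) : 0 <= lambda ->
  (forall i, eval g (x i) = eval f (x i)) -> `|g| ^+ 2 <= `|f| ^+ 2 ->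
  J g <= J f.
Proof.
move=> l0 gf ngf; rewrite /penalized_risk.
under eq_bigr do rewrite gf.
by rewrite lerD2l ler_wpM2l.
Qed.

(** The minimization runs over the vector of values at the distinct sample points. Where the risk is
    at most [J 0], the lower bound of [rho] bounds the norm, so these values stay in a compact
    box. *)
Lemma penalized_risk_minimizer :
  positive_definite_kernel K -> has_lbound (range rho) -> 0 < lambda ->
  exists b, argmin J (lincomb (section \o x) b).
Proof.
move=> [_ pdK] [c rho_c] l0.
have [N [s [inj_xs covers]]] := distinct_subfamily _ _ x.
pose w := x \o s; pose k := section \o w.
pose G := \matrix_(p, q) K (w p) (w q).
have Gunit : G \in unitmx.
  (* A nonzero [a] with [a *m G = 0] would have a vanishing quadratic form. *)
  rewrite -row_free_unit -kermx_eq0; apply/eqP/eqP/rowV0P => a /sub_kermxP aG0.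
  apply: contrapT => /eqP /(pdK _ w a inj_xs).
  rewrite exchange_big /= big1 ?ltxx// => q _.
  have := congr1 (fun u : 'rV_N => a 0 q * u 0 q) aG0; rewrite !mxE mulr0.
  by apply: etrans; rewrite mulr_sumr; apply: eq_bigr => p _; rewrite mxE; ring.
have eval_k a q : eval (lincomb k a) (w q) = (a *m G) 0 q.
  rewrite rkhs_reproducing linear_sumlz mxE; apply: eq_bigr => p _.
  by rewrite linearZl_LR /= rkhs_dot_section mxE.
pose vals f := \row_p eval f (w p).
pose interp v := lincomb k (v *m invmx G).
have interpE f p : eval (interp (vals f)) (w p) = eval f (w p).
  by rewrite eval_k -mulmxA mulVmx// mulmx1 mxE.
have interp_le f : J (interp (vals f)) <= J f.
  apply: penalized_risk_le; first exact: ltW.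
    by move=> i; have [p <-] := covers i; exact: interpE.
  set g := interp _.
  (* [f - g] vanishes at the points [w p], hence is orthogonal to their sections; Pythagoras then
     compares the norms. *)
  have gf0 : dot g (f - g) = 0.
    rewrite {1}/g linear_sumlz big1// => p _; rewrite linearZl_LR /=.
    rewrite rkhs_dotC -rkhs_reproducing linearB /= !fctE.
    by rewrite interpE subrr mulr0.
  rewrite -{1}(subrK g f) addrC rkhs_normD gf0 mulr0 addr0 lerDl.
  exact: sqr_ge0.
pose C0 := n%:R^-1 * \sum_(i < n) c.
have J_ge f : C0 + lambda * `|f| ^+ 2 <= J f.
  rewrite lerD2r ler_wpM2l ?invr_ge0//; apply: ler_sum => i _.
  by apply: rho_c; exists (y i - eval f (x i)).
(* [M] bounds the squared norm of [f] when [J f <= J 0]; [B p] then comes from [rkhs_dot_le], the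
   section at [w p] having squared norm [K (w p) (w p)]. *)
pose M := (J 0 - C0) / lambda.
pose B p := (M + K (w p) (w p)) / 2.
have vals_bound f p : J f <= J 0 -> - B p <= vals f 0 p <= B p.
  move=> f0; rewrite -ler_norml mxE rkhs_reproducing.
  apply: le_trans (rkhs_dot_le _ _) _; rewrite ler_pM2r ?invr_gt0//.
  rewrite -(rkhs_dot_section (w p)) -rkhs_normE lerD2r ler_pdivlMr//.
  by rewrite mulrC lerBrDl; exact: le_trans (J_ge f) f0.
pose box := [set v : 'rV[R]_N | forall p, `[- B p, B p]%classic (v 0 p)].
have in_box f : J f <= J 0 -> box (vals f).
  by move=> f0 p /=; rewrite in_itv /=; exact: vals_bound.
have cbox : compact box.
  apply: (@rV_compact R N (fun p => `[- B p, B p]%classic)) => p.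
  exact: segment_compact.
have cF : continuous (J \o interp).
  move=> v; apply: continuous_comp; last exact: penalized_risk_continuous.
  have -> : interp = lincomb (fun p => lincomb k (row p (invmx G))).
    by apply/funext => u; exact: lincomb_mulmx.
  exact: lincomb_continuous.
have box0 : box !=set0 by exists (vals 0); exact: in_box.
have [v _ vmin] := EVT_min_rV box0 cbox (continuous_subspaceT cF).
have {}vmin f : J f <= J 0 -> J (interp v) <= J f.
  move=> f0; apply: le_trans (interp_le f); apply: vmin.
  by rewrite inE; exact: in_box.
have [b bE] := lincomb_comp _ _ s (section \o x) (v *m invmx G).
exists b => f; rewrite bE -[lincomb _ _]/(interp v).
(* A function of risk above [J 0] may have values outside the box; it is compared with 0 instead. *)
have [|f0] := leP (J f) (J 0); first exact: vmin.
by apply: le_trans (ltW f0); exact: vmin.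
Qed.

End minimizer.
End rkhs_theory.

(** * Subspaces and rational nets *)

Lemma compact_set_type {T : topologicalType} (A : set T) :
  compact A -> compact [set: A].
Proof.
move=> cA F FF _.
have [|p [Ap clp]] := cA (fmap (@set_val T A) F) (fmap_proper_filter _ FF).
  rewrite /fmap /= (_ : _ @^-1` _ = setT); first exact: filterT.
  by apply/seteqP; split => // z _; exact: set_valP.
exists (exist _ p (mem_set Ap)); split => // U W FU.
rewrite nbhsE => -[_ [[V oV <-] Vp] VW].
have [||_ [[z Uz <-] Vz]] := clp (set_val @` U) V.
- exact: filterS (@preimage_image _ _ _ _) FU.
- by apply: open_nbhs_nbhs; split.
- by exists z; split => //; exact: VW.
Qed.

Lemma rV_ball_rat_dense {R : realType} n :
  exists q : nat -> 'rV[R]_n,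
    forall (a : 'rV[R]_n) (e : R), 0 < e -> exists j, ball (q j) e a.
Proof.
exists (fun j => map_mx ratr (odflt (0 : 'rV[rat]_n) (unpickle j))) => a e e0.
have /choice[r rP] (i : 'I_n) : exists r : rat, ball (ratr r : R) e (a 0 i).
  have [] := @dense_rat R (ball (a 0 i) e).
  - by exists (a 0 i); exact: ballxx.
  - exact: ball_open.
  - by move=> z [az [r _ rz]]; exists r; apply/ball_sym; rewrite rz.
exists (pickle (\row_i r i)); rewrite pickleK /=.
by split => // i j; rewrite !mxE ord1.
Qed.

Lemma set_val_open_preimage {R : realType} {d : nat} {X : set 'rV[R]_d}
    {disp : measure_display} {Omega : measurableType disp} (f : Omega -> X)
    (U : set X) :
  measurable_fun setT (fun w => set_val (f w) : borel 'rV[R]_d) ->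
  open U -> measurable (f @^-1` U).
Proof.
move=> mf [V oV <-]; rewrite -[X in measurable X]setTI.
by apply: mf => //; exact: sub_sigma_algebra.
Qed.

(** * Measurability of the risk and of the estimator *)

Section measurable_estimator.
Context {R : realType} {disp : measure_display} {Omega : measurableType disp}
  {T : topologicalType} {K : T -> T -> R} (H : rkhs K) {n : nat}.
Variable x : 'I_n -> Omega -> T.
Hypothesis mx : forall j,
  strongly_measurable (fun w => rkhs_section H (x j w) : H).

Lemma strongly_measurable_lincomb (a : Omega -> 'rV[R]_n) :
  strongly_measurable a ->
  strongly_measurable (fun w => lincomb (rkhs_section H \o x ^~ w) (a w)).
Proof.
move=> ma; apply: (@strongly_measurable_sum R _ _ H) => j.
apply: (@strongly_measurable_comp2 _ _ R H H (fun p => p.1 *: p.2)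
  (fun w => a w 0 j) (fun w => rkhs_section H (x j w))) (mx j).
  exact: scale_continuous.
exact: (@strongly_measurable_comp _ _ 'rV[R]_n R (fun b => b 0 j) _
  (@coord_continuous R 1 n 0 j) ma).
Qed.

Lemma measurable_penalized_risk (y : 'I_n -> Omega -> R) (rho : R -> R)
    (lambda : R) (f : Omega -> H) :
  continuous rho -> (forall i, measurable_fun setT (y i)) ->
  strongly_measurable f ->
  measurable_fun setT
    (fun w => penalized_risk rho lambda (x ^~ w) (y ^~ w) (f w)).
Proof.
move=> cts_rho my mf; apply: measurable_funD; apply: measurable_funM => //.
  apply: measurable_sum => i.
  apply: (measurableT_comp (continuous_measurable_fun cts_rho)).
  apply: measurable_funB => //; under eq_fun do rewrite rkhs_reproducing.
  apply: strongly_measurable_realfun.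
  exact: (@strongly_measurable_comp2 _ _ H H R
    (fun p => rkhs_dot H p.1 p.2) _ _ (rkhs_dot_continuous H) mf (mx i)).
apply: strongly_measurable_realfun.
exact: (@strongly_measurable_comp _ _ H R (fun f => `|f| ^+ 2) _
  sqr_norm_continuous mf).
Qed.

End measurable_estimator.

Theorem proposition1 (R : realType) (d : nat) (X : set 'rV[R]_d)
    (K : X -> X -> R) (H : rkhs K)
    (disp : measure_display) (Omega : measurableType disp)
    (P : probability Omega R)
    (n : nat) (x : 'I_n -> Omega -> X) (y eps : 'I_n -> Omega -> R)
    (f0 : 'rV[R]_d -> R)
    (v : probability (borel 'rV[R]_d) R) (mu : probability R R)
    (rho : R -> R) (lambda : R)
    (cptX : compact X)
    (ctsK : continuous (fun p : X * X => K p.1 p.2))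
    (pdK : positive_definite_kernel K)
    (n_gt0 : (0 < n)%N)
    (mxy : forall i, measurable_fun setT
       (fun w : Omega => (set_val (x i w), y i w) : borel 'rV[R]_d * R))
    (yE : forall i w, y i w = f0 (set_val (x i w)) + eps i w)
    (iid_x : iid_with_law P v (fun i w => set_val (x i w) : borel 'rV[R]_d))
    (supp_v : forall O : set X, open O -> O !=set0 -> (0 < v (set_val @` O))%E)
    (iid_eps : iid_with_law P mu eps)
    (cts_rho : continuous rho)
    (lb_rho : has_lbound (range rho))
    (lambda_gt0 : 0 < lambda) :
  let objective w := penalized_risk rho lambda (x ^~ w) (y ^~ w) : H -> R in
  (forall w, argmin (objective w) !=set0) /\
  exists fhat : Omega -> H,
    measurable_fun setT (fhat : Omega -> borel H) /\
    forall w, argmin (objective w) (fhat w).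
Proof.
move=> objective; have symK := pdK.1.
have cts_section := rkhs_section_continuous H symK ctsK.
have my i : measurable_fun setT (y i).
  exact: (measurableT_comp measurable_snd (mxy i)).
(* The sections form a compact subset of [H], the continuous image of [X]; its finite nets replace
   separability of [H]. *)
have msection j : strongly_measurable (fun w => rkhs_section H (x j w) : H).
  apply: (@compact_range_strongly_measurable _ _ _ H _
    (range (rkhs_section H))).
  - apply: continuous_compact (compact_set_type _ cptX).
    exact: continuous_subspaceT.
  - by move=> w; exists (x j w).
  - move=> U oU; apply: (set_val_open_preimage (x j) (rkhs_section H @^-1` U)).
      by have [mx _ _] := iid_x; exact: mx.
    by move/continuousP : cts_section; exact.
pose u w := rkhs_section H \o x ^~ w.
have minimizer w : exists b, argmin (objective w) (lincomb (u w) b).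
  exact: penalized_risk_minimizer.
pose Phi w a := objective w (lincomb (u w) a).
(* Some minimizer over [H] lies in the span, so minimizing over coefficients reaches the minimum
   over [H]. *)
have argmin_Phi w a :
    argmin (Phi w) a -> argmin (objective w) (lincomb (u w) a).
  move=> amin f; have [b bmin] := minimizer w.
  exact: le_trans (amin b) (bmin f).
have [q dq] := @rV_ball_rat_dense R n.
(* Compact cubes exhausting the coefficient space. *)
pose B (j : nat) :=
  [set a : 'rV[R]_n | forall i, `[- j%:R, j%:R]%classic (a 0 i)].
have [j|j|a|w|a|w|a [ma amin]] := measurable_argmin Phi q B dq.
- apply: (@rV_compact R n (fun=> `[- j%:R, j%:R]%classic)) => i.
  exact: segment_compact.
- rewrite (_ : B j = \bigcap_(i in setT)
    ((fun a : 'rV[R]_n => a 0 i) @^-1` `[- j%:R, j%:R]%classic)).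
    apply: closed_bigI => i _; apply: closed_comp; last exact: interval_closed.
    by move=> a _; exact: coord_continuous.
  by apply/seteqP; split => [a aB i _|a aB i]; exact: aB.
- exists (Num.bound (\sum_i `|a 0 i|)) => i /=; rewrite in_itv /= -ler_norml.
  apply: le_trans (ltW (archi_boundP _)); last exact: sumr_ge0.
  by rewrite (bigD1 i)//= lerDl sumr_ge0.
- move=> a; apply: (@continuous_comp _ _ _ (lincomb (u w)) (objective w)).
    exact: lincomb_continuous.
  exact: penalized_risk_continuous.
- apply: measurable_penalized_risk => //.
  by apply: strongly_measurable_lincomb => //; exact: strongly_measurable_cst.
- by have [b bmin] := minimizer w; exists b => c; exact: bmin.
split.
  by move=> w; have [b bmin] := minimizer w; exists (lincomb (u w) b).
exists (fun w => lincomb (u w) (a w)); split => [|w]; last exact: argmin_Phi.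
exact: (@strongly_measurable_borel R _ _ H _
  (strongly_measurable_lincomb H x msection a ma)).
Qed.
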